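(* Let $p$ be a prime, $\Gamma$ a free group of finite rank $n>1$ and $\bullet\in\{S,Z\}$. The extension $$0\to\mathrm{Hom}(\mathcal N_1^\bullet,\mathcal L_{k+1}^\bullet)\xrightarrow{\ i\ }\mathrm{Aut}(\mathcal N_{k+1}^\bullet)\xrightarrow{\ \psi_k^\bullet\ }\mathrm{Aut}(\mathcal N_k^\bullet)\to1$$ does not split for $k\ge2$.
   Context: For a group $G$ with lower central series $G_1=G$, $G_k=[G,G_{k-1}]$ and a prime $p$: the Stallings mod-$p$ central series is $G_1^S=G$, $G_k^S=[G,G_{k-1}^S](G_{k-1}^S)^p$; the Zassenhaus mod-$p$ central series is $G_k^Z=\prod_{ip^j\ge k}(G_i)^{p^j}$. Here $H^m$ denotes the subgroup generated by $m$-th powers. For $\bullet\in\{S,Z\}$ set $\mathcal N_k^\bullet=\Gamma/\Gamma_{k+1}^\bullet$ and $\mathcal L_k^\bullet=\Gamma_k^\bullet/\Gamma_{k+1}^\bullet$. $\psi_k^\bullet$ is induced by the quotient $\mathcal N_{k+1}^\bullet\to\mathcal N_k^\bullet$ by the characteristic subgroup $\mathcal L_{k+1}^\bullet$, and $i(f)=(\gamma\mapsto f([\gamma])\gamma)$ with $[\gamma]$ the class of $\gamma$ in $\mathcal N_1^\bullet$; the displayed sequence is exact. It splits if $\psi_k^\bullet$ has a section that is a group homomorphism. *)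

(* Defs.v *)
From HB Require Import structures.
From mathcomp Require Import all_boot.
From mathcomp Require Import boolp classical_sets.

Set Implicit Arguments.
Unset Strict Implicit.
Unset Printing Implicit Defensive.

Local Open Scope classical_set_scope.
Local Open Scope quotient_scope.
Local Open Scope group_scope.

(* The universal property; uniqueness is pointwise, so that it does not depend
   on the proof components of the bundled morphisms. *)
Definition free_basis (n : nat) (G : groupType) (x : 'I_n -> G) : Prop :=
  forall (H : groupType) (h : 'I_n -> H),
    exists2 f : {multiplicative G -> H}, forall i, f (x i) = h i
      & forall g : {multiplicative G -> H}, (forall i, g (x i) = h i) -> g =1 f.

Definition free_of_rank (n : nat) (G : groupType) : Prop :=
  exists x : 'I_n -> G, free_basis x.

Section Subsets.
Variable G : groupType.
Implicit Types A B : set G.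

Inductive gen A : set G :=
| gen_in x : A x -> gen A x
| gen_1 : gen A 1
| gen_M x y : gen A x -> gen A y -> gen A (x * y)
| gen_V x : gen A x -> gen A x^-1.

Definition comms A B : set G := gen [set [~ a, b] | a in A & b in B].
Definition pows A (m : nat) : set G := gen [set a ^+ m | a in A].
Definition prods A B : set G := [set a * b | a in A & b in B].

Record normal A : Prop := Normal {
  normal1 : A 1;
  normalM : forall x y, A x -> A y -> A (x * y);
  normalV : forall x, A x -> A x^-1;
  normalJ : forall x y, A x -> A (x ^ y)
}.

(* lcs 1 is the whole group; index 0 is a junk value. *)
Fixpoint lcs (k : nat) : set G :=
  match k with
  | 0 | 1 => setT
  | k'.+1 => comms setT (lcs k')
  end.

(* Same indexing as lcs. *)
Fixpoint stallings (p k : nat) : set G :=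
  match k with
  | 0 | 1 => setT
  | k'.+1 => prods (comms setT (stallings p k')) (pows (stallings p k') p)
  end.

(* The product of the (normal) subgroups (G_i)^(p^j) over the infinitely many
   pairs (i, j) is the subgroup generated by their union. *)
Definition zassenhaus (p k : nat) : set G :=
  gen [set x | exists i j : nat,
         [/\ (0 < i)%N, (k <= i * p ^ j)%N & pows (lcs i) (p ^ j) x]].

Lemma gen_normal A : (forall x y, A x -> A (x ^ y)) -> normal (gen A).
Proof.
move=> AJ; split; [exact: gen_1|exact: gen_M|exact: gen_V|].
move=> x y; elim=> {x} [x Ax||x z _ Ix _ Iz|x _ Ix].
- exact/gen_in/AJ.
- by rewrite conj1g; exact: gen_1.
- by rewrite conjMg; exact: gen_M.
- by rewrite conjVg; exact: gen_V.
Qed.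

Lemma normalT : normal setT. Proof. by split. Qed.

Lemma comms_normal A B : normal A -> normal B -> normal (comms A B).
Proof.
move=> nA nB; apply: gen_normal => _ y [a Aa [b Bb <-]].
exists (a ^ y); first exact: normalJ.
by exists (b ^ y); [exact: normalJ|rewrite conjRg].
Qed.

Lemma pows_normal A m : normal A -> normal (pows A m).
Proof.
move=> nA; apply: gen_normal => _ y [a Aa <-].
by exists (a ^ y); [exact: normalJ|rewrite conjXg].
Qed.

Lemma prods_normal A B : normal A -> normal B -> normal (prods A B).
Proof.
move=> nA nB; split.
- by exists 1; [exact: normal1|exists 1; [exact: normal1|rewrite mulg1]].
- move=> _ _ [a Aa [b Bb <-]] [c Ac [d Bd <-]].
  exists (a * c); first exact: normalM.
  exists (b ^ c * d); first by apply: normalM => //; apply: normalJ.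
  by rewrite !mulgA; congr (_ * d); rewrite -!mulgA -conjgC.
- move=> _ [a Aa [b Bb <-]].
  exists a^-1; first exact: normalV.
  exists (b^-1 ^ a^-1); first by apply: normalJ => //; exact: normalV.
  by rewrite -conjgC invgM.
- move=> _ y [a Aa [b Bb <-]].
  exists (a ^ y); first exact: normalJ.
  by exists (b ^ y); [exact: normalJ|rewrite conjMg].
Qed.

Lemma lcs_normal k : normal (lcs k).
Proof.
elim: k => [|[|k] IH]; [exact: normalT|exact: normalT|].
exact: comms_normal normalT IH.
Qed.

Lemma stallings_normal p k : normal (stallings p k).
Proof.
elim: k => [|[|k] IH]; [exact: normalT|exact: normalT|].
by apply: prods_normal; [exact: comms_normal normalT IH|exact: pows_normal].
Qed.

Lemma zassenhaus_normal p k : normal (zassenhaus p k).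
Proof.
apply: gen_normal => x y [i [j [i0 le_k xP]]]; exists i, j; split=> //.
exact: normalJ (pows_normal _ (lcs_normal i)) _ _ xP.
Qed.

Lemma gen_sub A B : normal B -> A `<=` B -> gen A `<=` B.
Proof.
move=> nB AB x; elim=> {x} [x /AB//||x y _ Ix _ Iy|x _ Ix].
- exact: normal1.
- exact: normalM.
- exact: normalV.
Qed.

Lemma normal_exp A x m : normal A -> A x -> A (x ^+ m).
Proof.
move=> nA Ax; elim: m => [|m IH]; first by rewrite expg0; exact: normal1.
by rewrite expgS; exact: normalM.
Qed.

Lemma stallingsS p k : stallings p k.+1 `<=` stallings p k.
Proof.
case: k => [//|k] _ [a + [b + <-]].
have nk := stallings_normal p k.+1 => Ha Hb; apply: normalM => //.
  apply: gen_sub Ha => // _ [c _ [d Sd <-]].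
  rewrite commgEr; apply: normalM => //; apply: normalJ => //.
  exact: normalV.
apply: gen_sub Hb => // _ [c Sc <-]; exact: normal_exp.
Qed.

Lemma zassenhausS p k : zassenhaus p k.+1 `<=` zassenhaus p k.
Proof.
apply: gen_sub; first exact: zassenhaus_normal.
move=> x [i [j [i0 lk xP]]]; apply: gen_in; exists i, j; split=> //.
exact: ltnW.
Qed.

End Subsets.

Arguments lcs G k : clear implicits.
Arguments stallings G p k : clear implicits.
Arguments zassenhaus G p k : clear implicits.

Variant bullet := Stallings | Zassenhaus.

Definition series (b : bullet) (p : nat) (G : groupType) (k : nat) : set G :=
  match b with
  | Stallings => stallings G p k
  | Zassenhaus => zassenhaus G p k
  end.

Arguments series b p G k : clear implicits.

Lemma series_normal b p G k : normal (series b p G k).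
Proof. by case: b; [exact: stallings_normal|exact: zassenhaus_normal]. Qed.

Lemma seriesS b p G k : series b p G k.+1 `<=` series b p G k.
Proof. by case: b; [exact: stallingsS|exact: zassenhausS]. Qed.

Section Images.
Variables (G H : groupType) (f : {multiplicative G -> H}).
Implicit Types A B : set G.

Lemma morph1 : f 1 = 1.
Proof. by apply: (mulgI (f 1)); rewrite -gmulfM !mulg1. Qed.

Lemma morphV x : f x^-1 = (f x)^-1.
Proof. by apply: (mulgI (f x)); rewrite -gmulfM !mulgV morph1. Qed.

Lemma morphX m x : f (x ^+ m) = f x ^+ m.
Proof. by elim: m => [|m IH]; rewrite ?expg0 ?morph1 // !expgS gmulfM IH. Qed.

Lemma morphR x y : f [~ x, y] = [~ f x, f y].
Proof. by rewrite !commgEl /conjg !gmulfM !morphV. Qed.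

Lemma image_gen A : f @` gen A = gen (f @` A).
Proof.
apply/seteqP; split.
  move=> _ [x + <-]; elim=> {x} [x Ax||x y _ Ix _ Iy|x _ Ix].
  - by apply: gen_in; exists x.
  - by rewrite morph1; exact: gen_1.
  - by rewrite gmulfM; exact: gen_M.
  - by rewrite morphV; exact: gen_V.
move=> y; elim=> {y} [_ [x Ax <-]||_ _ _ [x Ax <-] _ [y Ay <-]|_ _ [x Ax <-]].
- by exists x => //; exact: gen_in.
- by exists 1; [exact: gen_1|exact: morph1].
- by exists (x * y); [exact: gen_M|exact: gmulfM].
- by exists x^-1; [exact: gen_V|exact: morphV].
Qed.

Lemma image_comms A B : f @` comms A B = comms (f @` A) (f @` B).
Proof.
rewrite /comms image_gen; congr gen; apply/seteqP; split.
  move=> _ [_ [a Aa [b Bb <-]] <-]; exists (f a); first by exists a.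
  by exists (f b); [exists b|rewrite morphR].
move=> _ [_ [a Aa <-] [_ [b Bb <-] <-]].
by exists [~ a, b]; [exists a => //; exists b|rewrite morphR].
Qed.

Lemma image_pows A m : f @` pows A m = pows (f @` A) m.
Proof.
rewrite /pows image_gen; congr gen; apply/seteqP; split.
  by move=> _ [_ [a Aa <-] <-]; exists (f a); [exists a|rewrite morphX].
by move=> _ [_ [a Aa <-] <-]; exists (a ^+ m); [exists a|rewrite morphX].
Qed.

Lemma image_prods A B : f @` prods A B = prods (f @` A) (f @` B).
Proof.
apply/seteqP; split.
  move=> _ [_ [a Aa [b Bb <-]] <-]; exists (f a); first by exists a.
  by exists (f b); [exists b|rewrite gmulfM].
move=> _ [_ [a Aa <-] [_ [b Bb <-] <-]].
by exists (a * b); [exists a => //; exists b|rewrite gmulfM].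
Qed.

Hypothesis f_surj : forall y, exists x, f x = y.

Lemma image_T : f @` setT = setT.
Proof. by apply/seteqP; split=> // y _; have [x <-] := f_surj y; exists x. Qed.

Lemma image_lcs k : f @` lcs G k = lcs H k.
Proof.
elim: k => [|[|k] IH]; [exact: image_T|exact: image_T|].
by rewrite [LHS]image_comms IH image_T.
Qed.

Lemma image_series b p k : f @` series b p G k = series b p H k.
Proof.
case: b => /=.
  elim: k => [|[|k] IH]; [exact: image_T|exact: image_T|].
  by rewrite [LHS]image_prods image_comms image_pows IH image_T.
rewrite /zassenhaus image_gen; congr gen; apply/seteqP; split.
  move=> _ [x [i [j [i0 lk xP]]] <-]; exists i, j; split=> //.
  by rewrite -image_lcs -image_pows; exists x.
move=> y [i [j [i0 lk]]]; rewrite -image_lcs -image_pows => -[x xP <-].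
by exists x => //; exists i, j.
Qed.

End Images.

Section Quotient.
Variables (G : groupType) (N : set G) (nN : normal N).

Definition coset_rel : rel G := fun x y => `[< N (x^-1 * y) >].

Lemma coset_refl : reflexive coset_rel.
Proof. by move=> x; apply/asboolP; rewrite mulVg; exact: normal1. Qed.

Lemma coset_sym : symmetric coset_rel.
Proof.
by move=> x y; apply/asboolP/asboolP => /(normalV nN); rewrite invgM invgK.
Qed.

Lemma coset_trans : transitive coset_rel.
Proof.
move=> y x z /asboolP xy /asboolP yz; apply/asboolP.
by have := normalM nN xy yz; rewrite -mulgA mulVKg.
Qed.

Definition coset_equiv := EquivRel coset_rel coset_refl coset_sym coset_trans.

Definition quot : Type := {eq_quot coset_equiv}.

HB.instance Definition _ := Choice.copy quot {eq_quot coset_equiv}.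

Definition coset (x : G) : quot := \pi_({eq_quot coset_equiv}) x.
Definition rep (u : quot) : G := repr (u : {eq_quot coset_equiv}).

Lemma repK u : coset (rep u) = u.
Proof. exact: reprK. Qed.

Lemma coset_eq x y : coset x = coset y <-> N (x^-1 * y).
Proof.
split=> [/eqmodP/asboolP//|Nxy]; apply/eqmodP; exact/asboolP.
Qed.

Definition quot_mul (u v : quot) : quot := coset (rep u * rep v).
Definition quot_one : quot := coset 1.
Definition quot_inv (u : quot) : quot := coset (rep u)^-1.

Lemma coset_mul x y : quot_mul (coset x) (coset y) = coset (x * y).
Proof.
have /coset_eq xr := repK (coset x); have /coset_eq yr := repK (coset y).
apply/coset_eq; set r := rep _ in xr *; set s := rep _ in yr *.
have -> : (r * s)^-1 * (x * y) = (r^-1 * x) ^ s * (s^-1 * y).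
  by rewrite /conjg invgM !mulgA mulgK.
by apply: normalM yr => //; exact: normalJ.
Qed.

Lemma coset_inv x : quot_inv (coset x) = coset x^-1.
Proof.
have /coset_eq xr := repK (coset x).
apply/coset_eq; set r := rep _ in xr *; rewrite invgK.
have -> : r * x^-1 = ((r^-1 * x)^-1) ^ r^-1.
  by rewrite /conjg invgM !invgK mulgK.
by apply: normalJ => //; exact: normalV.
Qed.

Fact quot_mulA : associative quot_mul.
Proof.
move=> u v w; rewrite -(repK u) -(repK v) -(repK w).
by rewrite !coset_mul mulgA.
Qed.

Fact quot_mul1 : left_id quot_one quot_mul.
Proof. by move=> u; rewrite -(repK u) coset_mul mul1g. Qed.

Fact quot_mulr1 : right_id quot_one quot_mul.
Proof. by move=> u; rewrite -(repK u) coset_mul mulg1. Qed.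

Fact quot_mulV : left_inverse quot_one quot_inv quot_mul.
Proof. by move=> u; rewrite -(repK u) coset_inv coset_mul mulVg. Qed.

Fact quot_mulrV : right_inverse quot_one quot_inv quot_mul.
Proof. by move=> u; rewrite -(repK u) coset_inv coset_mul mulgV. Qed.

HB.instance Definition _ := isGroup.Build quot
  quot_mulA quot_mul1 quot_mulr1 quot_mulV quot_mulrV.

Fact cosetM : {morph coset : x y / x * y}.
Proof. by move=> x y; rewrite -coset_mul. Qed.

HB.instance Definition _ := isMultiplicative.Build G quot coset cosetM.

Lemma coset_surj u : exists x, coset x = u.
Proof. by exists (rep u); exact: repK. Qed.

End Quotient.

Section QuotientMap.
Variables (G : groupType) (M N : set G) (nM : normal M) (nN : normal N).
Hypothesis MN : M `<=` N.

Definition quot_map (u : quot nM) : quot nN := coset nN (rep u).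

Lemma quot_mapE x : quot_map (coset nM x) = coset nN x.
Proof. by apply/coset_eq; apply: MN; apply/(coset_eq nM); exact: repK. Qed.

Fact quot_mapM : {morph quot_map : u v / u * v}.
Proof.
move=> u v; rewrite -(repK u) -(repK v).
by rewrite -cosetM !quot_mapE cosetM.
Qed.

HB.instance Definition _ :=
  isMultiplicative.Build (quot nM) (quot nN) quot_map quot_mapM.

Lemma quot_map_eq u v :
  quot_map u = quot_map v <-> (coset nM @` N) (u^-1 * v).
Proof.
rewrite -(repK u) -(repK v) !quot_mapE; set x := rep u; set y := rep v.
rewrite -(morphV (coset nM)) -cosetM; split=> [/coset_eq Nxy|].
  by exists (x^-1 * y).
case=> z Nz /coset_eq /MN zxy; apply/coset_eq.
by have := normalM nN Nz zxy; rewrite mulVKg.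
Qed.

End QuotientMap.

Record autom (G : groupType) := Autom {
  autom_fun :> G -> G;
  autom_morph : {morph autom_fun : x y / x * y};
  autom_bij : bijective autom_fun
}.

HB.instance Definition _ (G : groupType) := gen_eqMixin (autom G).
HB.instance Definition _ (G : groupType) := gen_choiceMixin (autom G).
HB.instance Definition _ (G : groupType) (a : autom G) :=
  isMultiplicative.Build G G (autom_fun a) (autom_morph a).

Section AutomGroup.
Variable G : groupType.
Implicit Types a b c : autom G.

Lemma automP a b : a =1 b -> a = b.
Proof.
case: a b => [f fM fB] [g gM gB] /= /funext fg; case: g / fg in gM gB *.
by rewrite (Prop_irrelevance fM gM) (Prop_irrelevance fB gB).
Qed.

Lemma autom_surj a y : exists x, a x = y.
Proof. by have [g _ gK] := autom_bij a; exists (g y). Qed.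

Definition autom_one : autom G :=
  @Autom G id (fun _ _ => erefl) (Bijective (fun _ => erefl) (fun _ => erefl)).

(* Aut(G) acts on the left: (a * b) x = a (b x). *)
Definition autom_mul a b : autom G.
Proof.
apply: (@Autom G (a \o b)).
- by move=> x y /=; rewrite !autom_morph.
- exact: bij_comp (autom_bij a) (autom_bij b).
Defined.

Definition autom_inv_fun a : G -> G := fun y => projT1 (cid (autom_surj a y)).

Fact autom_invK a : cancel (autom_inv_fun a) a.
Proof. by move=> y; rewrite /autom_inv_fun; case: cid. Qed.

Fact autom_Kinv a : cancel a (autom_inv_fun a).
Proof. by move=> x; apply: (bij_inj (autom_bij a)); rewrite autom_invK. Qed.

Definition autom_inv a : autom G.
Proof.
apply: (@Autom G (autom_inv_fun a)).
- move=> x y; apply: (bij_inj (autom_bij a)).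
  by rewrite autom_morph !autom_invK.
- exact: Bijective (autom_invK a) (autom_Kinv a).
Defined.

Fact autom_mulA : associative autom_mul.
Proof. by move=> a b c; apply: automP. Qed.
Fact autom_mul1 : left_id autom_one autom_mul.
Proof. by move=> a; apply: automP. Qed.
Fact autom_mulr1 : right_id autom_one autom_mul.
Proof. by move=> a; apply: automP. Qed.
Fact autom_mulV : left_inverse autom_one autom_inv autom_mul.
Proof. by move=> a; apply: automP => x /=; rewrite autom_Kinv. Qed.
Fact autom_mulrV : right_inverse autom_one autom_inv autom_mul.
Proof. by move=> a; apply: automP => x /=; rewrite autom_invK. Qed.

HB.instance Definition _ := isGroup.Build (autom G)
  autom_mulA autom_mul1 autom_mulr1 autom_mulV autom_mulrV.

End AutomGroup.

Section Tower.
Variables (b : bullet) (p : nat) (G : groupType).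

Definition Nquot (k : nat) : groupType := quot (series_normal b p G k.+1).

Definition Nproj (k : nat) : Nquot k.+1 -> Nquot k :=
  @quot_map G _ _ (series_normal b p G k.+2) (series_normal b p G k.+1).

HB.instance Definition _ (k : nat) :=
  isMultiplicative.Build (Nquot k.+1) (Nquot k) (@Nproj k)
    (@quot_mapM G _ _ _ _ (@seriesS b p G k.+1)).

Definition Nlift (k : nat) (v : Nquot k) : Nquot k.+1 := coset _ (rep v).

Lemma NliftK k : cancel (@Nlift k) (@Nproj k).
Proof.
by move=> v; rewrite /Nproj quot_mapE ?repK//; exact: seriesS.
Qed.

(* The kernel of Nproj, i.e. the image of series k.+1 in Nquot k.+1, is
   the (k.+1)-st term of the series of Nquot k.+1. *)
Lemma Nproj_eq k (u v : Nquot k.+1) :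
  Nproj u = Nproj v <-> series b p (Nquot k.+1) k.+1 (u^-1 * v).
Proof.
rewrite -(image_series (@coset_surj _ _ (series_normal b p G k.+2))).
by apply: quot_map_eq; exact: seriesS.
Qed.

Lemma Nproj_autom k (a : autom (Nquot k.+1)) u v :
  Nproj u = Nproj v -> Nproj (a u) = Nproj (a v).
Proof.
move=> /Nproj_eq uv; apply/Nproj_eq.
rewrite -(morphV a) -autom_morph -(image_series (autom_surj a)).
by exists (u^-1 * v).
Qed.

(* Independent of the choice of lift, by psi_funE. *)
Definition psi_fun k (a : autom (Nquot k.+1)) (v : Nquot k) : Nquot k :=
  Nproj (a (Nlift v)).

Lemma psi_funE k (a : autom (Nquot k.+1)) u :
  psi_fun a (Nproj u) = Nproj (a u).
Proof. by apply: Nproj_autom; rewrite NliftK. Qed.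

Definition psi (k : nat) (a : autom (Nquot k.+1)) : autom (Nquot k).
Proof.
apply: (@Autom (Nquot k) (psi_fun a)).
- move=> v w; rewrite -(NliftK v) -(NliftK w) -gmulfM !psi_funE.
  by rewrite autom_morph gmulfM.
- exists (psi_fun a^-1) => v; rewrite -(NliftK v) !psi_funE.
  + by congr Nproj; exact: autom_Kinv.
  + by congr Nproj; exact: autom_invK.
Defined.

Lemma psiE k (a : autom (Nquot k.+1)) u : psi a (Nproj u) = Nproj (a u).
Proof. exact: psi_funE. Qed.

Fact psiM k : {morph @psi k : a c / a * c}.
Proof.
by move=> a c; apply: automP => v; rewrite -(NliftK v) /= !psi_funE.
Qed.

HB.instance Definition _ (k : nat) :=
  isMultiplicative.Build (autom (Nquot k.+1)) (autom (Nquot k)) (@psi k)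
    (@psiM k).

End Tower.

Arguments psi b p G k : clear implicits.

(* Splitting of 1 -> ker f -> E -> Q -> 1 only involves the projection f. *)
Definition splits (E Q : groupType) (f : {multiplicative E -> Q}) : Prop :=
  exists s : {multiplicative Q -> E}, cancel s f.

(* Main.v *)
(* Suppose s is a section.  In Aut(N_k) the inner automorphisms of x and of
   d = [y, x, ..., x] of weight k - 1 commute, since [d, x] has weight k.  Their
   images under s differ from the inner automorphisms of N_{k+1} by elements of
   ker psi_k, which are tested against homomorphisms f from N_{k+1} to the
   unitriangular group of size k + 2 over F_p.  This group has a filtration U_m
   (entries 1 + m-th superdiagonal and above) with [U_a, U_b] in U_{a+b},
   U_a^p in U_{ap} and U_{k+2} = 1, so f maps the m-th term of either series
   into U_m, and an element of ker psi_k changes f by a homomorphism into the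
   central subgroup U_{k+1}.  Such factors cancel, hence f([d, x]) commutes with
   f(x).  Lifting the free generators to x = 1 + sum_{i > 0} E_{i,i+1} and
   y = 1 + E_{0,1} gives f([[d, x], x]) = 1 + E_{0,k+1}, a contradiction.
   Working with f avoids Lazard's theorem, which would be needed to show
   directly that the Zassenhaus quotients are central of exponent p. *)
Require Import Defs.
From HB Require Import structures.
From mathcomp Require Import all_boot.
From mathcomp Require Import fingroup ssralg finalg zmodp matrix.
From mathcomp Require Import boolp classical_sets.

Set Implicit Arguments.
Unset Strict Implicit.
Unset Printing Implicit Defensive.

Import GRing.Theory.

Local Open Scope classical_set_scope.
Local Open Scope group_scope.

(** * Filtration of the unitriangular group *)

Section Unipotent.
Variables (F : finFieldType) (p n : nat).
Hypothesis charF : p \in [pchar F]%R.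
Local Notation M := 'M[F]_n.+2.
Local Notation U := {unit M}.
Implicit Types (A B : M) (g h : U).

Definition upper (m : nat) A : Prop :=
  forall i j : 'I_n.+2, j < i + m -> A i j = 0%R.

Lemma upperD m A B : upper m A -> upper m B -> upper m (A + B)%R.
Proof. by move=> uA uB i j ij; rewrite mxE uA // uB // addr0. Qed.

Lemma upperB m A B : upper m A -> upper m B -> upper m (A - B)%R.
Proof. by move=> uA uB i j ij; rewrite !mxE uA // uB // subr0. Qed.

Lemma upperM a b A B : upper a A -> upper b B -> upper (a + b) (A * B)%R.
Proof.
move=> uA uB i j ij; rewrite -mulmxE mxE big1 // => l _.
have [li|il] := ltnP l (i + a); first by rewrite uA ?mul0r.
rewrite uB ?mulr0 //; apply: leq_trans ij _.
by rewrite addnA leq_add2r.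
Qed.

Lemma upper_le a b A : a <= b -> upper b A -> upper a A.
Proof. by move=> ab uA i j ij; apply/uA/(leq_trans ij); rewrite leq_add2l. Qed.

Lemma upperX a m A : 0 < m -> upper a A -> upper (a * m) (A ^+ m)%R.
Proof.
case: m => // m _ uA; elim: m => [|m IH]; first by rewrite muln1.
by rewrite exprS mulnS; exact: upperM.
Qed.

Lemma upper_unit A : upper 1 (A - 1)%R -> A \is a GRing.unit.
Proof.
(* [det_trig] concerns lower triangular matrices, hence the transpose. *)
move=> uA; change (A \in unitmx); rewrite -unitmx_tr unitmxE.
have At (i j : 'I_n.+2) : i <= j -> (A^T)%R i j = (i == j)%:R%R.
  move=> ij; have := uA j i; rewrite addn1 ltnS => /(_ ij) /eqP.
  by rewrite !mxE subr_eq0 eq_sym => /eqP <-; rewrite eq_sym.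
rewrite det_trig; last first.
  by apply/is_trig_mxP => i j ij; rewrite At ?(ltnW ij) // -val_eqE ltn_eqF.
by rewrite big1 ?unitr1 // => i _; rewrite At // eqxx.
Qed.

Definition unip (m : nat) g : Prop := upper m (val g - 1)%R.

Lemma unip1 m : unip m 1.
Proof. by move=> i j _; rewrite [val _]FinRing.val_unit1 subrr mxE. Qed.

Lemma unipM m g h : unip m g -> unip m h -> unip m (g * h).
Proof.
rewrite /unip FinRing.val_unitM => ug uh.
have -> : (val g * val h - 1 =
    (val g - 1) * (val h - 1) + (val g - 1) + (val h - 1))%R.
  by rewrite mulrBr mulr1 subrK mulrBl mul1r addrA subrK.
apply: upperD => //; apply: upperD => //.
by apply: upper_le (upperM ug uh); exact: leq_addr.
Qed.

Lemma unipX m e g : unip m g -> unip m (g ^+ e).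
Proof.
move=> ug; elim: e => [|e IH]; first exact: unip1.
by rewrite expgS; exact: unipM.
Qed.

(** In a finite group the inverse is a power, so closure under products suffices. *)
Lemma unipV m g : unip m g -> unip m g^-1.
Proof. by move=> ug; rewrite invg_expg; exact: unipX. Qed.

Lemma unip_le a b g : a <= b -> unip b g -> unip a g.
Proof. exact: upper_le. Qed.

Lemma unip_eq1 m g : n.+2 <= m -> unip m g -> g = 1.
Proof.
move=> nm ug; apply: val_inj; apply/eqP; rewrite -subr_eq0; apply/eqP/matrixP.
move=> i j; rewrite [RHS]mxE; apply: ug; apply: leq_trans (ltn_ord j) _.
exact: leq_trans nm (leq_addl _ _).
Qed.

(** With A = g - 1 and B = h - 1, [g, h] - 1 = (h g)^-1 (A B - B A), and multiplying by (h g)^-1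
    preserves the filtration. *)
Lemma unipR a b g h : 0 < a -> 0 < b -> unip a g -> unip b h ->
  unip (a + b) [~ g, h].
Proof.
move=> a0 b0 ug uh; rewrite /unip.
have u1 : unip 1 ((h * g)^-1).
  by apply/unipV/unipM; [apply: unip_le uh|apply: unip_le ug].
have -> : (val [~ g, h] - 1 = val ((h * g)^-1)%g *
    ((val g - 1) * (val h - 1) - (val h - 1) * (val g - 1)))%R.
  have -> : [~ g, h] = (h * g)^-1 * (g * h) by rewrite (commgC g) mulKg.
  have e1 : (val ((h * g)^-1)%g * val (h * g)%g = 1)%R.
    by rewrite -FinRing.val_unitM mulVg.
  rewrite FinRing.val_unitM -[X in (_ - X)%R = _]e1 -mulrBr; congr (_ * _)%R.
  have E (u x y e : M) : (u - x - (y - e) = u - (x + y - e))%R.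
    by rewrite -(addrA x y) (opprD x) addrA.
  rewrite !FinRing.val_unitM !mulrBr !mulrBl !mulr1 !mul1r.
  rewrite (E _ (val h)) (E _ (val g)) [(val h + val g)%R]addrC.
  by rewrite (opprB (val h * val g)%R) addrA subrK.
set C := (_ - _)%R.
have uC : upper (a + b) C.
  by apply: upperB; [|rewrite addnC]; exact: upperM.
rewrite -[val _](subrK 1%R) mulrDl mul1r; apply: upperD => //.
apply: upper_le (upperM u1 uC); exact: leq_addl.
Qed.

(** Frobenius is additive on the commuting elements g and 1, so g^p - 1 = (g - 1)^p. *)
Lemma unipXp a g : unip a g -> unip (a * p) (g ^+ p).
Proof.
move=> ug; rewrite /unip FinRing.val_unitX.
have chM : p \in [pchar M]%R by rewrite pchar_lalg.
have cg : GRing.comm (val g) 1%R by exact: commr1.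
rewrite -(pFrobenius_autE chM) -(pFrobenius_aut1 chM).
rewrite -(pFrobenius_autB_comm chM cg) pFrobenius_autE.
by apply: upperX ug; exact/prime_gt0/(pcharf_prime charF).
Qed.

End Unipotent.

(** * Commutators and comparison of the central series *)

Lemma conjg_commute (G : groupType) (x y : G) : commute x y -> x ^ y = x.
Proof. by move=> xy; rewrite conjgE xy mulKg. Qed.

Lemma morphJ (G H : groupType) (f : {multiplicative G -> H}) x y :
  f (x ^ y) = f x ^ f y.
Proof. by rewrite !conjgE !gmulfM morphV. Qed.

Lemma comms_in (G : groupType) (A B : set G) x y :
  A x -> B y -> comms A B [~ x, y].
Proof. by move=> Ax By; apply: gen_in; exists x => //; exists y. Qed.

Lemma lcs_series b p (G : groupType) m : 0 < p -> 0 < m ->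
  lcs G m `<=` series b p G m.
Proof.
move=> p0; case: m => // m _; case: b => /= x.
  elim: m x => [//|m IH] x xm; exists x; last by exists 1;
    [exact: gen_1|rewrite mulg1].
  apply: gen_sub xm; first exact/comms_normal/stallings_normal/normalT.
  by move=> _ [u _ [v vm <-]]; apply: comms_in => //; exact: IH.
move=> xm; apply: gen_in; exists m.+1, 0; rewrite expn0 muln1; split=> //.
by apply: gen_in; exists x; rewrite ?expg1.
Qed.

Lemma series_le b p (G : groupType) m l : m <= l ->
  series b p G l `<=` series b p G m.
Proof.
elim: l => [|l IH]; first by rewrite leqn0 => /eqP ->.
rewrite leq_eqVlt => /orP[/eqP <- //|/IH ml] u /seriesS; exact: ml.
Qed.

(** * Images of the series under unitriangular representations *)

Section Representations.
Variables (F : finFieldType) (p n : nat).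
Hypothesis charF : p \in [pchar F]%R.
Local Notation U := {unit 'M[F]_n.+2}.

Lemma unip_central (z g : U) : unip n.+1 z -> unip 1 g -> commute z g.
Proof.
move=> uz ug; apply/commgP/eqP; apply: (@unip_eq1 _ _ n.+2) => //.
by rewrite -addn1; exact: unipR.
Qed.

Variables (G : groupType) (f : {multiplicative G -> U}) (a : nat).
Hypothesis a_gt0 : 0 < a.
Hypothesis f_unip : forall u, unip a (f u).

(** Since x^y = x [x, y], conjugation preserves depth; normality lets [gen_sub] test the series on
    generators only. *)
Lemma preim_unip_normal m : 0 < m -> Defs.normal [set u | unip m (f u)].
Proof.
move=> m0; split=> /=.
- by rewrite morph1; exact: unip1.
- by move=> x y ux uy; rewrite gmulfM; exact: unipM.
- by move=> x ux; rewrite morphV; exact: unipV.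
- move=> x y ux; rewrite morphJ -[_ ^ _](mulVKg (f x)) -commgEl.
  apply: unipM => //; apply: unip_le (unipR m0 a_gt0 ux (f_unip y)).
  exact: leq_addr.
Qed.

Lemma lcs_unip m u : 0 < m -> lcs G m u -> unip (a * m) (f u).
Proof.
case: m => // m _; elim: m u => [|m IH] u; first by rewrite muln1.
have nK : Defs.normal [set v | unip (a * m.+2) (f v)].
  by apply: preim_unip_normal; rewrite muln_gt0 a_gt0.
apply: (gen_sub nK) => _ [x _ [y /IH yP <-]] /=.
by rewrite morphR mulnS; apply: unipR => //; rewrite muln_gt0 a_gt0.
Qed.

(** Commutators add weights and p-th powers multiply them by p. The weight a will be 1 for a
    representation and k + 1 for the central homomorphism attached to a kernel element. *)
Lemma series_unip b m u : 0 < m -> series b p G m u -> unip (a * m) (f u).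
Proof.
have p_gt1 : 1 < p by exact/prime_gt1/(pcharf_prime charF).
have nK l : 0 < l -> Defs.normal [set v | unip (a * l) (f v)].
  by move=> l0; apply: preim_unip_normal; rewrite muln_gt0 a_gt0.
case: m => // m _; case: b => /=.
  elim: m u => [|m IH] u; first by rewrite muln1.
  case=> x xP [y yP <-]; rewrite gmulfM; apply: unipM.
    move: x xP; apply: (gen_sub (nK m.+2 isT)) => _ [v _ [w /IH wP <-]] /=.
    by rewrite morphR mulnS; apply: unipR => //; rewrite muln_gt0 a_gt0.
  move: y yP; apply: (gen_sub (nK m.+2 isT)) => _ [v /IH vP <-] /=.
  (* It suffices that (m + 1) p >= m + 2, which holds as p >= 2. *)
  rewrite morphX; apply: unip_le (unipXp charF vP).
  rewrite -mulnA leq_pmul2l //; apply: leq_trans (leq_mul (leqnn _) p_gt1).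
  by rewrite muln2 -addnn addSn ltnS leq_addl.
apply: (gen_sub (nK m.+1 isT)) => {}u [i [j [i0 mij]]].
apply: (gen_sub (nK m.+1 isT)) => _ [v /(lcs_unip i0) vP <-] /=.
rewrite morphX; apply: (@unip_le _ _ _ (a * (i * p ^ j))).
  by rewrite leq_pmul2l.
elim: j {mij} => [|j IH]; first by rewrite expn0 expg1 muln1.
by rewrite expnSr expgnA !mulnA -(mulnA a); exact: unipXp.
Qed.

End Representations.

(** * The kernel of [psi] seen through a representation *)

Section Kernel.
Variables (F : finFieldType) (b : bullet) (p k : nat) (G : groupType).
Hypotheses (charF : p \in [pchar F]%R) (k_gt0 : 0 < k).
Local Notation N := (Nquot b p G k.+1).
Local Notation U := {unit 'M[F]_k.+2}.
Variable f : {multiplicative N -> U}.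
Hypothesis f_unip : forall u, unip 1 (f u).

Lemma psi_ker_diff (h : autom N) (u : N) : psi b p G k h = 1 ->
  series b p N k.+1 (u^-1 * h u).
Proof. by move=> h1; apply/Nproj_eq; rewrite -psiE h1. Qed.

(** Take z(u) = f(u)^-1 f(h u): its values lie in U_{k+1}, and their centrality makes z
    multiplicative. *)
Lemma psi_ker_rep (h : autom N) : psi b p G k h = 1 ->
  exists2 z : {multiplicative N -> U}, forall u, f (h u) = f u * z u &
    forall u, unip k.+1 (z u).
Proof.
move=> h1; pose z u := (f u)^-1 * f (h u).
have zu u : unip k.+1 (z u).
  rewrite /z -morphV -gmulfM.
  have := series_unip charF (isT : 0 < 1) f_unip _ (psi_ker_diff u h1).
  by rewrite mul1n; apply.
have zM : {morph z : u v / u * v}.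
  move=> u v; rewrite {1}/z !gmulfM invgM -!mulgA (mulgA _ (f (h u))).
  rewrite -/(z u) (mulgA _ (z u)) -(unip_central (zu u)); last first.
    exact/unipV/f_unip.
  by rewrite -!mulgA.
pose zB := isMultiplicative.Build N U z zM.
pose zm : {multiplicative N -> U} := HB.pack z zB.
by exists zm => u //=; rewrite /z mulVKg.
Qed.

(** The last premise says that [inner x * h] and [inner y * h'] commute. Under f, each side becomes
    a conjugate of f(u) times the same central factors z(u) and z'(u), which cancel. *)
Lemma psi_ker_comm (h h' : autom N) (x y : N) :
    psi b p G k h = 1 -> psi b p G k h' = 1 ->
    (forall u, h (h' u ^ y) ^ x = h' (h u ^ x) ^ y) ->
  forall u, f (u ^ (y * x)) = f (u ^ (x * y)).
Proof.
have half (g g' : autom N) v w (z z' : {multiplicative N -> U}) :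
    psi b p G k g' = 1 ->
    (forall u, f (g u) = f u * z u) -> (forall u, unip k.+1 (z u)) ->
    (forall u, f (g' u) = f u * z' u) -> (forall u, unip k.+1 (z' u)) ->
    forall u, f (g (g' u ^ w) ^ v) = f (u ^ (w * v)) * (z' u * z u).
  move=> g1 gz zu gz' zu' u.
  have fix_conj c s : unip k.+1 c -> c ^ f s = c.
    by move=> uc; apply/conjg_commute/unip_central.
  (* Conjugation does not affect central values, and [g'] moves u by an element of the second term,
     where z has values in U_{2(k+1)} = 1. *)
  have zg' : z (g' u ^ w) = z u.
    rewrite morphJ conjg_commute; last first.
      by apply: unip_central => //; apply: unip_le (zu w).
    rewrite -[g' u](mulVKg u) gmulfM [X in _ * X](_ : _ = 1) ?mulg1 //.
    have z2 := series_unip charF (isT : 0 < k.+1) zu (isT : 0 < 2).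
    apply: unip_eq1 (z2 b _ _).
      by rewrite muln2 -addnn addSn !ltnS leq_addl.
    exact: series_le (psi_ker_diff u g1).
  rewrite morphJ gz zg' morphJ gz' (conjMg (f u)) (fix_conj (z' u)) //.
  rewrite conjMg (fix_conj (z u)) // conjMg (fix_conj (z' u)) //.
  by rewrite !morphJ gmulfM conjgM mulgA.
move=> h1 h1' hh u.
have [z hz zu] := psi_ker_rep h1; have [z' hz' zu'] := psi_ker_rep h1'.
have := congr1 f (hh u); rewrite (half _ _ _ _ _ _ h1' hz zu hz' zu').
rewrite (half _ _ _ _ _ _ h1 hz' zu' hz zu).
rewrite (unip_central (zu' u)); first exact: mulIg.
exact: unip_le (zu u).
Qed.

End Kernel.

(** * Inner automorphisms and a hypothetical section *)

Definition inner (G : groupType) (x : G) : autom G :=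
  @Autom G (conjg^~ x) (fun u v => conjMg u v x)
    (Bijective (conjgK x) (conjgKV x)).

Section Splitting.
Variables (F : finFieldType) (b : bullet) (p k : nat) (G : groupType).
Hypotheses (charF : p \in [pchar F]%R) (k_gt0 : 0 < k).
Local Notation N := (Nquot b p G k.+1).

(** Being in the k-th term, [x, y] is central modulo the (k+1)-st, so x y and y x conjugate alike
    there. *)
Lemma psi_inner_commute (x y : G) : lcs G k [~ x, y] ->
  psi b p G k (inner (coset _ x)) * psi b p G k (inner (coset _ y)) =
  psi b p G k (inner (coset _ y)) * psi b p G k (inner (coset _ x)).
Proof.
move=> xy; rewrite -!gmulfM; apply: automP => v.
rewrite -(NliftK v) -(repK (Nlift v)); set g := rep _.
rewrite !psiE /= -!conjgM -!gmulfM -!morphJ /Nproj !quot_mapE;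
  try exact: seriesS.
rewrite (commgC x y) (conjgM g (y * x)).
apply/coset_eq; rewrite -commgEl; apply: lcs_series => //.
  exact/prime_gt0/(pcharf_prime charF).
by case: (k) k_gt0 xy => // m _ xy; exact: comms_in.
Qed.

Lemma splits_conj (f : {multiplicative N -> {unit 'M[F]_k.+2}}) (x y : N) :
    (forall u, unip 1 (f u)) -> splits (psi b p G k) ->
    psi b p G k (inner x) * psi b p G k (inner y) =
      psi b p G k (inner y) * psi b p G k (inner x) ->
  forall u, f (u ^ (y * x)) = f (u ^ (x * y)).
Proof.
move=> f1 [s sK] xy.
(* [s (psi a)] and [a] have the same image under [psi], so they differ by a kernel element. *)
have ker_s a : psi b p G k (a^-1 * s (psi b p G k a)) = 1.
  by rewrite gmulfM morphV sK mulVg.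
have s_inner a : s (psi b p G k a) = a * (a^-1 * s (psi b p G k a)).
  by rewrite mulVKg.
have s_xy := congr1 s xy; rewrite !gmulfM (s_inner (inner x)) in s_xy.
rewrite (s_inner (inner y)) in s_xy.
apply: (psi_ker_comm charF k_gt0 f1 (ker_s (inner x)) (ker_s (inner y))) => u.
exact: (congr1 (fun a : autom N => a u) s_xy).
Qed.

End Splitting.

(** * Explicit unitriangular matrices and representations of a free group *)

Lemma quot_lift (G H : groupType) (K : set G) (nK : Defs.normal K)
    (g : {multiplicative G -> H}) : (forall x, K x -> g x = 1) ->
  exists f : {multiplicative quot nK -> H}, forall x, f (coset nK x) = g x.
Proof.
move=> gK; pose f (v : quot nK) := g (rep v).
have fE x : f (coset nK x) = g x.
  have /coset_eq/gK := repK (coset nK x).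
  by rewrite gmulfM morphV => /(canRL (mulVKg _)); rewrite mulg1.
have fM : {morph f : u v / u * v}.
  move=> u v; rewrite -(repK u) -(repK v); set x := rep u; set y := rep v.
  by rewrite -cosetM !fE gmulfM.
pose fB := isMultiplicative.Build (quot nK) H f fM.
by exists (HB.pack f fB : {multiplicative quot nK -> H}).
Qed.

Section UnipotentCommutators.
Variables (F : finFieldType) (n : nat).
Local Notation M := 'M[F]_n.+2.
Local Notation U := {unit M}.

(** [inord m] is m only for m <= n + 1 and defaults to 0 beyond, hence the upper bounds on m
    below. *)
Definition first_row (m : nat) : M := delta_mx 0%R (inord m).
Definition shift : M := (\matrix_(i, j) ((0 < i) && (j == i.+1 :> nat))%:R)%R.

Lemma upper_first_row m : 0 < m <= n.+1 -> upper 1 (first_row m).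
Proof.
case/andP=> m0 mn i j; rewrite addn1 ltnS => ji; rewrite mxE.
case: andP => // -[/eqP i0 /eqP jm].
by move: ji m0; rewrite i0 jm inordK // leqn0 => /eqP ->.
Qed.

Lemma upper_shift : upper 1 shift.
Proof.
move=> i j; rewrite addn1 ltnS => ji; rewrite mxE.
by case: eqP ji => [->|]; rewrite ?ltnn // andbF.
Qed.

Lemma first_rowM m l : 0 < m <= n.+1 ->
  (first_row m * first_row l = 0)%R.
Proof.
case/andP=> m0 mn; rewrite -mulmxE mul_delta_mx_0 //.
by rewrite -val_eqE /= inordK // -lt0n.
Qed.

Lemma shift_first_row m : (shift * first_row m = 0)%R.
Proof.
apply/matrixP => i j; rewrite -mulmxE !mxE big1 // => l _; rewrite !mxE.
by case: (eqVneq l 0%R) => [->|_]; rewrite ?andbF ?mul0r ?mulr0.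
Qed.

Lemma first_row_shift m : 0 < m <= n ->
  (first_row m * shift = first_row m.+1)%R.
Proof.
case/andP=> m0 mn; apply/matrixP => i j; rewrite -mulmxE !mxE.
rewrite (bigD1 (inord m)) //= big1 ?addr0 => [|l lm]; last first.
  by rewrite !mxE (negPf lm) andbF mul0r.
rewrite !mxE eqxx andbT inordK ?m0 /=; last by rewrite ltnS leqW.
rewrite -(val_eqE j) /= inordK //.
by case: eqP => _; case: eqP => _; rewrite ?mulr0 ?mul1r ?mul0r.
Qed.

(* [c = 1 + E], [x = 1 + S] with [S E = 0] and [E S = E']. *)
Lemma commg_first_row m (c x c' : U) : 0 < m <= n ->
  val c = (1 + first_row m)%R -> val x = (1 + shift)%R ->
  val c' = (1 + first_row m.+1)%R -> [~ c, x] = c'.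
Proof.
move=> /andP[m0 mn] cE xE c'E; apply: (mulgI (x * c)); rewrite -commgC.
apply: val_inj; rewrite !FinRing.val_unitM cE xE c'E.
rewrite !mulrDl !mulrDr !mul1r !mulr1 !mulrDl !mul1r.
rewrite !shift_first_row first_rowM ?m0 1?ltnW //.
rewrite first_row_shift ?m0 // !addr0 !mul0r ?addr0.
by rewrite -!addrA (addrC shift) !addrA.
Qed.

(** Starting from 1 + E_{0,1}, each commutator with x moves the entry one column to the right; n
    steps reach the corner. *)
Lemma unipotent_commutators : exists x y : U, [/\ unip 1 x, unip 1 y &
  iter n (fun d => [~ d, x]) y != 1].
Proof.
have u1 (A : M) : upper 1 A -> upper 1 (1 + A - 1)%R by rewrite addrC addKr.
pose e m (mn : 0 < m <= n.+1) : U :=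
  FinRing.Unit (upper_unit (u1 _ (upper_first_row mn))).
pose x : U := FinRing.Unit (upper_unit (u1 _ upper_shift)).
exists x, (e 1%N isT); split; [exact: u1 upper_shift|exact/u1/upper_first_row|].
have iterE m (mn : 0 < m.+1 <= n.+1) : 
    iter m (fun d => [~ d, x]) (e 1%N isT) = e m.+1 mn.
  elim: m mn => [|m IH] mn; first exact: val_inj.
  rewrite iterS (IH (ltnW mn)); exact: (@commg_first_row m.+1).
rewrite (iterE n (ltnSn _)); apply/eqP => /(congr1 val) /=.
move/eqP; rewrite -subr_eq0 addrC addKr => /eqP /matrixP.
move=> /(_ 0%R (inord n.+1)); rewrite !mxE !eqxx.
by apply/eqP; exact: oner_neq0.
Qed.

End UnipotentCommutators.

(** Using the unitriangular subgroup itself as target of the universal property makes every value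
    unipotent. *)
Lemma free_unipotent_rep (F : finFieldType) (m n : nat) (G : groupType)
    (x : 'I_m -> G) (X : 'I_m -> {unit 'M[F]_n.+2}) :
  free_basis x -> (forall i, unip 1 (X i)) ->
  exists2 f : {multiplicative G -> {unit 'M[F]_n.+2}},
    forall i, f (x i) = X i & forall u, unip 1 (f u).
Proof.
move=> free_x uX.
pose D : {set {unit 'M[F]_n.+2}} := [set g | `[< unip 1 g >]]%SET.
have gD : group_set D.
  apply/group_setP; split; first by rewrite finset.inE; apply/asboolP/unip1.
  move=> g h; rewrite !finset.inE => /asboolP ug /asboolP uh.
  exact/asboolP/unipM.
have XD i : X i \in Group gD by rewrite finset.inE; apply/asboolP.
have [f fx _] := free_x (subg_of (Group gD)) (fun i => subg (Group gD) (X i)).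
pose g u : {unit 'M[F]_n.+2} := sgval (f u).
have gM : {morph g : u v / u * v} by move=> u v; rewrite /g gmulfM.
pose gB := isMultiplicative.Build G {unit 'M[F]_n.+2} g gM.
exists (HB.pack g gB : {multiplicative G -> {unit 'M[F]_n.+2}}) => [i|u] /=.
  by rewrite /g fx subgK.
by have := subgP (f u); rewrite finset.inE => /asboolP.
Qed.

(** * Contradiction from iterated commutators of two free generators *)

Theorem corollary4p4p6 (p : nat) (p_prime : prime p) (n : nat) (n_gt1 : 1 < n)
    (Gamma : groupType) (Gamma_free : free_of_rank n Gamma)
    (b : bullet) (k : nat) (k_ge2 : 2 <= k) :
  ~ splits (psi b p Gamma k).
Proof.
(* From here k is the original index minus 2, so matrices have size k + 4. *)
case: k k_ge2 => [|[|k]] // _ split_psi.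
have charF : p \in [pchar 'F_p]%R by exact: pchar_Fp.
have [X [Y [uX uY XY1]]] := unipotent_commutators 'F_p k.+2.
have [x free_x] := Gamma_free; pose i0 := Ordinal (ltnW n_gt1).
have [g gx g1] : exists2 g : {multiplicative Gamma -> {unit 'M['F_p]_k.+4}},
    forall i, g (x i) = (if i == i0 then X else Y) & forall u, unip 1 (g u).
  by apply: free_unipotent_rep free_x _ => i; case: ifP.
have [f fE] : exists f : {multiplicative
    Nquot b p Gamma k.+3 -> {unit 'M['F_p]_k.+4}},
    forall u, f (coset _ u) = g u.
  (* [g] sends the (k+4)-th term into U_{k+4}, which is trivial in this size. *)
  apply: quot_lift => u /(series_unip charF (isT : 0 < 1) g1) -/(_ isT).
  by rewrite mul1n; exact: unip_eq1.
have f1 u : unip 1 (f u) by rewrite -(repK u) fE.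
pose d m := iter m (fun u => [~ u, x i0]) (x (Ordinal n_gt1)).
have d_lcs m : lcs Gamma m.+1 (d m).
  (* [lcs] brackets with the whole group on the left, [d] on the right; inversion swaps the two. *)
  elim: m => [//|m IH]; rewrite /d iterS -invgR; apply: gen_V.
  by apply: comms_in.
have xd : lcs Gamma k.+2 [~ x i0, d k] by apply: comms_in (d_lcs k).
have inner_xd := @psi_inner_commute _ b _ _ _ charF (isT : 0 < k.+2) _ _ xd.
have g_conj u : g (u ^ (d k * x i0)) = g (u ^ (x i0 * d k)).
  have := splits_conj charF (isT : 0 < k.+2) f1 split_psi inner_xd (coset _ u).
  by rewrite -!gmulfM -!morphJ !fE.
have gd m : g (d m) = iter m (fun u => [~ u, X]) Y.
  elim: m => [|m IH]; first by rewrite gx.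
  by rewrite /d !iterS -IH morphR gx eqxx.
case/negP: XY1; rewrite -gd /d !iterS -/(d k) morphR gx eqxx commg1_sym.
(* With this u, the equality of conjugates says that g([d k, x_0]) centralizes X. *)
apply/conjg_fixP; have := g_conj (x i0 ^ (x i0 * d k)^-1).
rewrite conjgKV (commgC (d k)) conjgM conjgKV.
by rewrite !morphJ gx eqxx.
Qed.
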